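(* Let $p$ be a prime number and let $B$ be a perfect completely integrally closed $\mathbf{F}_p$-domain. Then the ring of Witt vectors $\mathbf{W}(B)$ is a completely integrally closed domain, hence integrally closed.
   Context: All rings are commutative with unity. An $\mathbf{F}_p$-algebra $B$ is perfect if the Frobenius map $b\mapsto b^p$ on $B$ is bijective. $\mathbf{W}(B)$ denotes the ring of $p$-typical Witt vectors of $B$. Let $A$ be an integral domain with field of fractions $K$. An element $x\in K$ is almost integral over $A$ if there is a nonzero element $a\in A$ such that $ax^n\in A$ for all $n\ge 1$. $A$ is completely integrally closed if every element of $K$ that is almost integral over $A$ belongs to $A$. *)

(* Defs.v *)
From HB Require Import structures.
From mathcomp Require Import all_boot all_order all_algebra.
From mathcomp Require Import finmap.
From mathcomp Require Import boolp.
From mathcomp.multinomials Require Import monalg.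

Set Implicit Arguments.
Unset Strict Implicit.
Unset Printing Implicit Defensive.

Import GRing.Theory Num.Theory.

Local Open Scope ring_scope.

(* The n-th ghost component x_0^(p^n) + p x_1^(p^(n-1)) + ... + p^n x_n. *)
Definition ghost (p : nat) (R : comNzRingType) (n : nat) (x : nat -> R) : R :=
  \sum_(i < n.+1) p%:R ^+ i * x i ^+ (p ^ (n - i)).

(* Integer polynomials in the indeterminates X_(k, i), k, i : nat; the
   indeterminate X_(k, i) plays the role of the i-th coordinate of the k-th
   Witt vector argument. *)
Notation wpoly := {malg int[{cmonom (nat * nat)%type}]}.

Definition wvar (k i : nat) : wpoly := << ucm (k, i) >>.

Definition wevalm (R : comNzRingType) (v : nat * nat -> R)
    (m : {cmonom (nat * nat)%type}) : R :=
  \prod_(i <- finsupp m) v i ^+ m i.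

Definition weval (R : comNzRingType) (v : nat * nat -> R) (f : wpoly) : R :=
  mmap intr (wevalm v) f.

(* Coefficientwise Euclidean quotient; it is only used for exact divisions. *)
Definition wdiv (d : nat) (f : wpoly) : wpoly :=
  \sum_(m <- msupp f) << (f@_m %/ d%:Z)%Z *g m >>.

(* The sequence [s] solving [ghost p n s = Phi n] for all [n], obtained by
   [s_n = (Phi n - \sum_(i < n) p^i s_i^(p^(n-i))) / p^n].  The divisions
   are exact, and the equations hold, by [ghost_solveP] for the three sequences
   [Phi] used below. *)
Fixpoint ghost_solve_seq (p : nat) (Phi : nat -> wpoly) (n : nat) : seq wpoly :=
  if n is m.+1 then
    let s := ghost_solve_seq p Phi m in
    rcons s (wdiv (p ^ m)
      (Phi m - \sum_(i < m) p%:R ^+ i * s`_i ^+ (p ^ (m - i))))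
  else [::].

Definition ghost_solve (p : nat) (Phi : nat -> wpoly) (n : nat) : wpoly :=
  (ghost_solve_seq p Phi n.+1)`_n.

(* Witt polynomials; locked because unification diverges when unfolding them. *)
HB.lock Definition wadd (p : nat) : nat -> wpoly :=
  ghost_solve p (fun n => ghost p n (wvar 0) + ghost p n (wvar 1)).
HB.lock Definition wopp (p : nat) : nat -> wpoly :=
  ghost_solve p (fun n => - ghost p n (wvar 0)).
HB.lock Definition wmul (p : nat) : nat -> wpoly :=
  ghost_solve p (fun n => ghost p n (wvar 0) * ghost p n (wvar 1)).

Definition wargs (R : comNzRingType) (x y z : nat -> R) (ki : nat * nat) : R :=
  match ki.1 with 0%N => x ki.2 | 1%N => y ki.2 | _ => z ki.2 end.

Section Weval.
Variables (R : comNzRingType) (v : nat * nat -> R).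

Fact wevalm_mmorphism : mmorphism (wevalm v).
Proof.
have E (d : {fset (nat * nat)%type}) (m : {cmonom (nat * nat)%type}) : (finsupp m `<=` d)%fset ->
    wevalm v m = \prod_(i <- d) v i ^+ m i.
  move=> le; rewrite /wevalm (big_fset_incl _ le) // => i _.
  by rewrite -cmE_neq0 negbK => /eqP ->.
split=> [m1 m2|]; last by rewrite /wevalm mdom1 big_seq_fset0.
rewrite {1}/wevalm mdomD (E _ m1 (fsubsetUl _ (finsupp m2))).
rewrite (E _ m2 (fsubsetUr (finsupp m1) _)) -big_split /=.
by apply: eq_bigr => i _; rewrite cmM exprD.
Qed.

HB.instance Definition _ :=
  isMultiplicative.Build _ R (wevalm v) wevalm_mmorphism.

HB.instance Definition _ := GRing.RMorphism.copy (weval v)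
  (mmap (intr : int -> R) (wevalm v)).

Lemma weval_var k i : weval v (wvar k i) = v (k, i).
Proof.
rewrite /weval /wvar mmapU mul1r /wevalm mdomU big_seq_fset1 cmUU.
by rewrite expr1.
Qed.

End Weval.

Lemma weval_rmorph (R S : comNzRingType) (g : {rmorphism R -> S})
    (v : nat * nat -> R) (f : wpoly) :
  g (weval v f) = weval (g \o v) f.
Proof.
rewrite /weval /mmap rmorph_sum; apply: eq_bigr => m _.
rewrite rmorphM rmorph_int rmorph_prod; congr (_ * _).
by apply: eq_bigr => i _; rewrite rmorphXn.
Qed.

Lemma eq_weval (R : comNzRingType) (v w : nat * nat -> R) :
  v =1 w -> weval v =1 weval w.
Proof.
move=> vw f; apply: eq_bigr => m _; congr (_ * _).
by apply: eq_bigr => i _; rewrite vw.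
Qed.

Lemma wmonM (m1 m2 : {cmonom (nat * nat)%type}) :
  << m1 >> * << m2 >> = << mmul m1 m2 >> :> wpoly.
Proof. by rewrite malgM_def fgmulUU mulr1. Qed.

Lemma wmon1 : << mone >> = 1 :> wpoly.
Proof. exact: mpolyC1E. Qed.

Lemma wevalm_id (R : comNzRingType) (u : {cmonom (nat * nat)%type} -> R) m :
  u mone = 1 -> (forall m1 m2, u (mmul m1 m2) = u m1 * u m2) ->
  wevalm (fun ki => u (ucm ki)) m = u m.
Proof.
move=> u1 uM; rewrite /wevalm.
have H (s : seq (nat * nat)) : uniq s -> exists2 m' : {cmonom (nat * nat)%type},
    \prod_(i <- s) u (ucm i) ^+ m i = u m' &
    forall j, m' j = (if j \in s then m j else 0)%N.
  elim: s => [_|i s IHs /= /andP[i_s /IHs[m' m'E m'j]]].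
    by exists mone => [|j]; rewrite ?big_nil ?u1 // cm1.
  have [m2 m2E m2j] : exists2 m2 : {cmonom (nat * nat)%type},
      u (ucm i) ^+ m i = u m2 &
      forall j, m2 j = (if j == i then m i else 0)%N.
    elim: (m i) => [|n [m2 m2E m2j]].
      by exists mone => [|j]; [rewrite u1 expr0|rewrite cm1 if_same].
    exists (mmul (ucm i) m2) => [|j]; first by rewrite exprS m2E uM.
    by rewrite cmM m2j cmU eq_sym; case: eqP.
  exists (mmul m2 m') => [|j]; first by rewrite big_cons m2E m'E uM.
  rewrite cmM m2j m'j inE; case: eqP => [->|_] //=.
  by rewrite (negPf i_s) addn0.
have [m' -> m'j] := H _ (fset_uniq (finsupp m)).
by congr u; apply/eqP/cmP => j; rewrite m'j; case: finsuppP.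
Qed.

Lemma weval_id (f : wpoly) : weval (fun ki => wvar ki.1 ki.2) f = f.
Proof.
rewrite [RHS]monalgE; apply: eq_bigr => m _.
have -> : wevalm (fun ki => wvar ki.1 ki.2) m = << m >>.
  rewrite -(@wevalm_id _ (fun m => << m >> : wpoly) m wmon1).
    by apply: eq_bigr => -[k i] _.
  by move=> m1 m2; rewrite wmonM.
rewrite -(rmorph_int (@malgC _ _)) intz.
by rewrite [LHS]malgM_def fgmulUU mulr1 mul1m.
Qed.

Lemma wpoly_natr_coef n (f : wpoly) m : (n%:R * f : wpoly)@_m = n%:Z * f@_m.
Proof. by rewrite mulr_natl mcoeffMn -mulr_natl natz. Qed.

Lemma wpoly_natrI n : (0 < n)%N -> injective (fun f : wpoly => n%:R * f).
Proof.
move=> n0 f g /= fg; apply/malgP => m.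
have : n%:Z * f@_m = n%:Z * g@_m by rewrite -!wpoly_natr_coef fg.
by apply: mulfI; rewrite eqz_nat -lt0n.
Qed.

Lemma wdiv_mull d f : (0 < d)%N -> wdiv d (d%:R * f) = f.
Proof.
move=> d0; rewrite [RHS]monalgE /wdiv.
have -> : msupp (d%:R * f : wpoly) = msupp f.
  apply/fsetP => m; rewrite -!mcoeff_neq0 wpoly_natr_coef mulf_eq0.
  by rewrite eqz_nat -[d == 0%N]negbK -lt0n d0.
apply: eq_bigr => m _; rewrite wpoly_natr_coef mulKz //.
by rewrite eqz_nat -lt0n.
Qed.

Section Congruence.
Variables (p : nat) (p_pr : prime p) (R : comNzRingType).

Definition pcong n (a b : R) := exists q, a = b + p%:R ^+ n * q.

Lemma pcong_refl n a : pcong n a a.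
Proof. by exists 0; rewrite mulr0 addr0. Qed.

Lemma pcong_sym n a b : pcong n a b -> pcong n b a.
Proof. by case=> q ->; exists (- q); rewrite mulrN addrK. Qed.

Lemma pcong_trans n b a c : pcong n a b -> pcong n b c -> pcong n a c.
Proof. by case=> q -> [r ->]; exists (r + q); rewrite mulrDr addrA. Qed.

Lemma pcongD n a b c d : pcong n a b -> pcong n c d -> pcong n (a + c) (b + d).
Proof. by case=> q -> [r ->]; exists (q + r); rewrite mulrDr addrACA. Qed.

Lemma pcongN n a b : pcong n a b -> pcong n (- a) (- b).
Proof. by case=> q ->; exists (- q); rewrite opprD mulrN. Qed.

Lemma pcongM n a b c d : pcong n a b -> pcong n c d -> pcong n (a * c) (b * d).
Proof.
case=> q -> [r ->]; exists (b * r + q * d + q * (p%:R ^+ n * r)).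
rewrite mulrDl !mulrDr -!addrA; congr (_ + _).
by rewrite [b * _]mulrCA !mulrA.
Qed.

Lemma pcongX n k a b : pcong n a b -> pcong n (a ^+ k) (b ^+ k).
Proof.
move=> ab; elim: k => [|k IHk]; first exact: pcong_refl.
by rewrite !exprS; apply: pcongM.
Qed.

Lemma pcong_sum n I (r : seq I) (F G : I -> R) :
  (forall i, pcong n (F i) (G i)) ->
  pcong n (\sum_(i <- r) F i) (\sum_(i <- r) G i).
Proof.
move=> FG; elim: r => [|i r IHr]; first by rewrite !big_nil; apply: pcong_refl.
by rewrite !big_cons; apply: pcongD.
Qed.

Lemma pcong_pM n k a b :
  pcong n a b -> pcong (k + n) (p%:R ^+ k * a) (p%:R ^+ k * b).
Proof. by case=> q ->; exists q; rewrite mulrDr exprD mulrA. Qed.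

Lemma pcong_expp n a b : pcong n.+1 a b -> pcong n.+2 (a ^+ p) (b ^+ p).
Proof.
move=> ab; suff [q [-> q0]] : exists q, a ^+ p = b ^+ p + (a - b) * q /\ pcong 1 q 0.
  case: ab q0 => r -> [s ->]; exists (r * s).
  rewrite [b + _ - b]addrC addKr add0r expr1 [p%:R ^+ n.+2]exprSr -!mulrA.
  by rewrite [r * _]mulrCA.
exists (\sum_(i < p) a ^+ (p.-1 - i) * b ^+ i); split.
  by rewrite -subrXX addrC subrK.
have ab1 : pcong 1 a b.
  by case: ab => q ->; exists (p%:R ^+ n * q); rewrite mulrA -exprD.
apply: (@pcong_trans _ (\sum_(i < p) b ^+ p.-1)).
  have -> : \sum_(i < p) b ^+ p.-1 = \sum_(i < p) b ^+ (p.-1 - i) * b ^+ i.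
    apply: eq_bigr => i _; rewrite -exprD subnK //.
    by rewrite -ltnS prednK ?prime_gt0.
  by apply: pcong_sum => i; apply: pcongM; [apply: pcongX|apply: pcong_refl].
by exists (b ^+ p.-1); rewrite sumr_const card_ord add0r expr1 mulr_natl.
Qed.

Lemma pcong_exppn n a b : pcong 1 a b -> pcong n.+1 (a ^+ (p ^ n)) (b ^+ (p ^ n)).
Proof.
move=> ab; elim: n => [|n IHn]; first by rewrite !expr1.
by rewrite expnSr !exprM; apply: pcong_expp.
Qed.

Lemma pcong_freshman a b : pcong 1 ((a + b) ^+ p) (a ^+ p + b ^+ p).
Proof.
have p0 := prime_gt0 p_pr; rewrite exprDn.
rewrite -(big_mkord xpredT (fun i => a ^+ (p - i) * b ^+ i *+ 'C(p, i))).
rewrite big_nat_recl // -[X in \sum_(0 <= i < X) _](prednK p0).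
rewrite big_nat_recr //= (prednK p0).
rewrite subn0 subnn !expr0 mulr1 mul1r bin0 binn !mulr1n.
rewrite big_mkord [\sum_(i < _) _ + _]addrC addrA.
set s := \sum_(i < _) _.
have [q ->] : pcong 1 s 0.
  suff : pcong 1 s (\sum_(i < p.-1) 0) by rewrite big1_eq.
  apply: pcong_sum => i.
  have /dvdnP[k ->] : (p %| 'C(p, i.+1))%N.
    by apply: prime_dvd_bin => //; rewrite -ltn_predRL ltn_ord.
  exists (k%:R * (a ^+ (p - i.+1) * b ^+ i.+1)).
  by rewrite -mulr_natl natrM add0r expr1 [k%:R * _ in LHS]mulrC -mulrA.
by rewrite add0r; exists q.
Qed.

Lemma frob_weval (g : {rmorphism R -> R}) (v : nat * nat -> R) (f : wpoly) :
  (forall ki, pcong 1 (g (v ki)) (v ki ^+ p)) ->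
  pcong 1 (g (weval v f)) (weval v f ^+ p).
Proof.
pose C a := pcong 1 (g a) (a ^+ p); move=> Cv.
have CD a b : C a -> C b -> C (a + b).
  move=> Ca Cb; rewrite /C rmorphD /=; apply: pcong_trans (pcongD Ca Cb) _.
  exact/pcong_sym/pcong_freshman.
have CM a b : C a -> C b -> C (a * b).
  by move=> Ca Cb; rewrite /C rmorphM /= exprMn; apply: pcongM.
have C1 : C 1 by rewrite /C rmorph1 expr1n; apply: pcong_refl.
have C0 : C 0.
  by rewrite /C rmorph0 expr0n eqn0Ngt prime_gt0 //; apply: pcong_refl.
have CX n a : C a -> C (a ^+ n).
  by move=> Ca; elim: n => [|n IHn]; rewrite ?expr0 // exprS; apply: CM.
have CN1 : C (-1).
  rewrite /C rmorphN rmorph1 /=; apply: pcong_sym.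
  have := pcong_freshman 1 (-1).
  rewrite subrr expr0n eqn0Ngt prime_gt0 //= expr1n => /pcong_sym h.
  by have := pcongD (pcong_refl 1 (-1)) h; rewrite addKr addr0.
have Cn n : C n%:R.
  by elim: n => [|n IHn] //; rewrite mulrS; apply: CD.
have Cz (z : int) : C z%:~R.
  case: z => n; first exact: Cn.
  by rewrite NegzE mulrNz -mulN1r; apply: CM (Cn _).
apply: (big_ind C) => // m _; apply: (CM); first exact: Cz.
by rewrite /wevalm; apply: (big_ind C C1 CM) => i _; apply/CX/Cv.
Qed.

Lemma ghost_recr n (x : nat -> R) : ghost p n x =
  \sum_(i < n) p%:R ^+ i * x i ^+ (p ^ (n - i)) + p%:R ^+ n * x n.
Proof. by rewrite /ghost big_ord_recr /= subnn expr1. Qed.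

Lemma eq_ghost_tail n (s t : nat -> R) : (forall i, (i < n)%N -> s i = t i) ->
  \sum_(i < n) p%:R ^+ i * s i ^+ (p ^ (n - i)) =
  \sum_(i < n) p%:R ^+ i * t i ^+ (p ^ (n - i)).
Proof. by move=> st; apply: eq_bigr => i _; rewrite st. Qed.

Lemma ghost_inj (s t : nat -> R) : (forall n, injective ( *%R (p%:R ^+ n : R))) ->
  (forall n, ghost p n s = ghost p n t) -> s =1 t.
Proof.
move=> inj st n; elim/ltn_ind: n => n IHn; have := st n.
by rewrite !ghost_recr (eq_ghost_tail IHn) => /addrI/inj.
Qed.

Lemma ghost_rmorph (S : comNzRingType) (g : {rmorphism R -> S}) n (x : nat -> R) :
  g (ghost p n x) = ghost p n (fun i => g (x i)).
Proof.
rewrite /ghost rmorph_sum; apply: eq_bigr => i _.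
by rewrite rmorphM !rmorphXn rmorph_nat.
Qed.

Section Dwork.
Variable g : {rmorphism R -> R}.

Definition ghostlike (Phi : nat -> R) :=
  forall n, pcong n.+1 (Phi n.+1) (g (Phi n)).

Lemma ghostlike_var (x : nat -> R) :
  (forall i, g (x i) = x i ^+ p) -> ghostlike (fun n => ghost p n x).
Proof.
move=> gx n; exists (x n.+1); rewrite ghost_recr ghost_rmorph; congr (_ + _).
apply: eq_bigr => i _; rewrite gx -exprM -expnS subSn //.
by rewrite -ltnS.
Qed.

Lemma ghostlikeD Phi Psi : ghostlike Phi -> ghostlike Psi ->
  ghostlike (fun n => Phi n + Psi n).
Proof. by move=> h k n; rewrite rmorphD; apply: pcongD. Qed.

Lemma ghostlikeN Phi : ghostlike Phi -> ghostlike (fun n => - Phi n).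
Proof. by move=> h n; rewrite rmorphN; apply: pcongN. Qed.

Lemma ghostlikeM Phi Psi : ghostlike Phi -> ghostlike Psi ->
  ghostlike (fun n => Phi n * Psi n).
Proof. by move=> h k n; rewrite rmorphM; apply: pcongM. Qed.

(* Dwork's lemma *)
Lemma dwork (Phi s : nat -> R) :
  (forall a, pcong 1 (g a) (a ^+ p)) -> ghostlike Phi ->
  (forall n q,
     Phi n - \sum_(i < n) p%:R ^+ i * s i ^+ (p ^ (n - i)) = p%:R ^+ n * q ->
     s n = q) ->
  forall n, ghost p n s = Phi n.
Proof.
move=> gp gPhi sP n.
pose S m := \sum_(i < m) p%:R ^+ i * s i ^+ (p ^ (m - i)).
have step m : pcong m (Phi m) (S m) -> ghost p m s = Phi m.
  case=> q E; rewrite ghost_recr -/(S m) (sP m q) // E.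
  by rewrite -/(S m) [S m + _]addrC addrK.
elim: n => [|n IHn].
  by apply: step; exists (Phi 0 - S 0); rewrite mul1r addrC subrK.
apply: step; apply: pcong_trans (gPhi n) _.
rewrite -IHn ghost_rmorph; apply: pcong_sum => i.
have le_in : (i <= n)%N by rewrite -ltnS.
rewrite subSn // expnS exprM.
have {1}-> : n.+1 = (i + (n - i).+1)%N by rewrite addnS subnKC.
by apply: pcong_pM; apply: pcong_exppn.
Qed.

End Dwork.

End Congruence.

Section GhostSolve.
Variables (p : nat) (p_pr : prime p).

Definition wfrob (f : wpoly) : wpoly :=
  weval (fun ki => wvar ki.1 ki.2 ^+ p) f.
HB.instance Definition _ := GRing.RMorphism.copy wfrob
  (weval (fun ki => wvar ki.1 ki.2 ^+ p)).

Lemma wfrob_var k i : wfrob (wvar k i) = wvar k i ^+ p.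
Proof. exact: weval_var. Qed.

Lemma wfrob_cong f : pcong p 1 (wfrob f) (f ^+ p).
Proof.
have := @frob_weval p p_pr _ wfrob (fun ki => wvar ki.1 ki.2) f _.
rewrite weval_id; apply=> ki.
rewrite /= wfrob_var; exact: pcong_refl.
Qed.

Lemma ghostlike_wvar k : ghostlike p wfrob (fun n => ghost p n (wvar k)).
Proof. by apply: ghostlike_var => i; exact: wfrob_var. Qed.

Lemma size_ghost_solve_seq Phi n : size (ghost_solve_seq p Phi n) = n.
Proof. by elim: n => //= n IHn; rewrite size_rcons IHn. Qed.

Lemma nth_ghost_solve_seq Phi n i :
  (i < n)%N -> (ghost_solve_seq p Phi n)`_i = ghost_solve p Phi i.
Proof.
elim: n => // n IHn; rewrite ltnS leq_eqVlt => /predU1P[->|lt_in] //.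
by rewrite /= nth_rcons size_ghost_solve_seq lt_in IHn.
Qed.

Lemma ghost_solveE Phi n : ghost_solve p Phi n = wdiv (p ^ n)
  (Phi n - \sum_(i < n) p%:R ^+ i * ghost_solve p Phi i ^+ (p ^ (n - i))).
Proof.
rewrite {1}/ghost_solve /= nth_rcons size_ghost_solve_seq ltnn eqxx.
apply: (congr1 (fun t => wdiv (p ^ n) (Phi n - t))).
by apply: eq_ghost_tail => i; exact: nth_ghost_solve_seq.
Qed.

Lemma ghost_solveP Phi n :
  ghostlike p wfrob Phi -> ghost p n (ghost_solve p Phi) = Phi n.
Proof.
move=> gPhi; apply: (dwork p_pr wfrob_cong gPhi) => m q E.
rewrite ghost_solveE E -natrX.
by apply: wdiv_mull; rewrite expn_gt0 prime_gt0.
Qed.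

Lemma wpoly_ghost_inj (s t : nat -> wpoly) :
  (forall n, ghost p n s = ghost p n t) -> s =1 t.
Proof.
apply: ghost_inj => n; rewrite -natrX; apply: wpoly_natrI.
by rewrite expn_gt0 prime_gt0.
Qed.

End GhostSolve.

(* The primality proof is a parameter of the type because the Witt polynomials
   have integral coefficients, and hence define a ring structure, only for
   prime [p]. *)
Record witt (p : nat) (p_pr : prime p) (B : comNzRingType) : Type :=
  Witt { wcoord :> nat -> B }.

Section WittRing.
Variables (p : nat) (p_pr : prime p).

Section Operations.
Variable B : comNzRingType.
Local Notation W := (witt p_pr B).
Implicit Types x y z : W.

Lemma wittP x y : (forall n, x n = y n) -> x = y.
Proof. by case: x => x; case: y => y /= /funext ->. Qed.

HB.instance Definition _ := gen_eqMixin W.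
HB.instance Definition _ := gen_choiceMixin W.

Definition witt_zero : W := Witt p_pr (fun _ => 0).
Definition witt_add x y : W :=
  Witt p_pr (fun n => weval (wargs x y witt_zero) (wadd p n)).
Definition witt_opp x : W :=
  Witt p_pr (fun n => weval (wargs x witt_zero witt_zero) (wopp p n)).
Definition witt_mul x y : W :=
  Witt p_pr (fun n => weval (wargs x y witt_zero) (wmul p n)).
Definition witt_one : W := Witt p_pr (fun n => (n == 0%N)%:R).

Lemma weval_ghost_var (v : nat * nat -> B) n k :
  weval v (ghost p n (wvar k)) = ghost p n (fun i => v (k, i)).
Proof. by rewrite ghost_rmorph; apply: eq_bigr => i _; rewrite /= weval_var. Qed.

Lemma ghost_wadd n x y : ghost p n (witt_add x y) = ghost p n x + ghost p n y.
Proof.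
have E := ghost_solveP p_pr n (ghostlikeD (ghostlike_wvar p 0) (ghostlike_wvar p 1)).
apply: etrans (esym (ghost_rmorph p (weval (wargs x y witt_zero)) n (wadd p))) _.
rewrite wadd.unlock; apply: etrans (congr1 (weval _) E) _.
apply: etrans (rmorphD (weval _) _ _) _.
by congr (_ + _); apply: etrans (weval_ghost_var _ _ _) _.
Qed.

Lemma ghost_wopp n x : ghost p n (witt_opp x) = - ghost p n x.
Proof.
have E := ghost_solveP p_pr n (ghostlikeN (ghostlike_wvar p 0)).
apply: etrans (esym (ghost_rmorph p (weval (wargs x witt_zero witt_zero)) n (wopp p))) _.
rewrite wopp.unlock; apply: etrans (congr1 (weval _) E) _.
apply: etrans (rmorphN (weval _) _) _.
by congr (- _); apply: etrans (weval_ghost_var _ _ _) _.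
Qed.

Lemma ghost_wmul n x y : ghost p n (witt_mul x y) = ghost p n x * ghost p n y.
Proof.
have E := ghost_solveP p_pr n (ghostlikeM (ghostlike_wvar p 0) (ghostlike_wvar p 1)).
apply: etrans (esym (ghost_rmorph p (weval (wargs x y witt_zero)) n (wmul p))) _.
rewrite wmul.unlock; apply: etrans (congr1 (weval _) E) _.
apply: etrans (rmorphM (weval _) _ _) _.
by congr (_ * _); apply: etrans (weval_ghost_var _ _ _) _.
Qed.

Lemma ghost_wzero n : ghost p n witt_zero = 0.
Proof.
apply: big1 => i _; rewrite expr0n eqn0Ngt expn_gt0 prime_gt0 //=.
by rewrite mulr0.
Qed.

Lemma ghost_wone n : ghost p n witt_one = 1.
Proof.
rewrite /ghost big_ord_recl /= mul1r expr1n big1 ?addr0 // => i _.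
by rewrite expr0n eqn0Ngt expn_gt0 prime_gt0 //= mulr0.
Qed.

End Operations.

Section Functoriality.
Variables (R S : comNzRingType) (h : {rmorphism R -> S}).

Definition witt_map (x : witt p_pr R) : witt p_pr S :=
  Witt p_pr (fun n => h (x n)).

Fact witt_map_add x y :
  witt_map (witt_add x y) = witt_add (witt_map x) (witt_map y).
Proof.
apply: wittP => n; rewrite /= weval_rmorph; apply: eq_weval => -[[|[|k]] i] //.
exact: rmorph0.
Qed.

Fact witt_map_opp x : witt_map (witt_opp x) = witt_opp (witt_map x).
Proof.
apply: wittP => n; rewrite /= weval_rmorph.
by apply: eq_weval => -[[|[|k]] i] //; exact: rmorph0.
Qed.

Fact witt_map_mul x y :
  witt_map (witt_mul x y) = witt_mul (witt_map x) (witt_map y).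
Proof.
apply: wittP => n; rewrite /= weval_rmorph; apply: eq_weval => -[[|[|k]] i] //.
exact: rmorph0.
Qed.

Fact witt_map_zero : witt_map (witt_zero _) = witt_zero _.
Proof. by apply: wittP => n; exact: rmorph0. Qed.

Fact witt_map_one : witt_map (witt_one _) = witt_one _.
Proof. by apply: wittP => n; exact: rmorph_nat. Qed.

End Functoriality.

(* Identities between Witt vectors over [B] are images of identities over
   [wpoly], where the ghost map is injective. *)
Section Transfer.
Variables (P B : comNzRingType).
Hypothesis P_inj : forall s t : nat -> P,
  (forall n, ghost p n s = ghost p n t) -> s =1 t.
Hypothesis P_lift : forall x y z : witt p_pr B, exists h : {rmorphism P -> B},
  exists a b c, [/\ witt_map h a = x, witt_map h b = y & witt_map h c = z].

Let ghostE := (ghost_wadd, ghost_wopp, ghost_wmul, ghost_wzero, ghost_wone).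
Let mapE := (witt_map_add, witt_map_opp, witt_map_mul).

Let P_eq (a b : witt p_pr P) : (forall n, ghost p n a = ghost p n b) -> a = b.
Proof. by move/P_inj => ab; apply: wittP. Qed.

Fact witt_addA_transfer (x y z : witt p_pr B) :
  witt_add x (witt_add y z) = witt_add (witt_add x y) z.
Proof.
have [h [a [b [c [<- <- <-]]]]] := P_lift x y z.
rewrite -?(witt_map_zero h) -?(witt_map_one h) -!mapE.
apply: (congr1 (witt_map h)); apply: P_eq => n.
by rewrite !ghostE addrA.
Qed.

Fact witt_addC_transfer (x y : witt p_pr B) :
  witt_add x y = witt_add y x.
Proof.
have [h [a [b [c [<- <- _]]]]] := P_lift x y x.
rewrite -?(witt_map_zero h) -?(witt_map_one h) -!mapE.
apply: (congr1 (witt_map h)); apply: P_eq => n.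
by rewrite !ghostE addrC.
Qed.

Fact witt_add0_transfer (x : witt p_pr B) :
  witt_add (witt_zero _) x = x.
Proof.
have [h [a [b [c [<- _ _]]]]] := P_lift x x x.
rewrite -?(witt_map_zero h) -?(witt_map_one h) -!mapE.
apply: (congr1 (witt_map h)); apply: P_eq => n.
by rewrite !ghostE add0r.
Qed.

Fact witt_addN_transfer (x : witt p_pr B) :
  witt_add (witt_opp x) x = witt_zero _.
Proof.
have [h [a [b [c [<- _ _]]]]] := P_lift x x x.
rewrite -?(witt_map_zero h) -?(witt_map_one h) -!mapE.
apply: (congr1 (witt_map h)); apply: P_eq => n.
by rewrite !ghostE addNr.
Qed.

Fact witt_mulA_transfer (x y z : witt p_pr B) :
  witt_mul x (witt_mul y z) = witt_mul (witt_mul x y) z.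
Proof.
have [h [a [b [c [<- <- <-]]]]] := P_lift x y z.
rewrite -?(witt_map_zero h) -?(witt_map_one h) -!mapE.
apply: (congr1 (witt_map h)); apply: P_eq => n.
by rewrite !ghostE mulrA.
Qed.

Fact witt_mulC_transfer (x y : witt p_pr B) :
  witt_mul x y = witt_mul y x.
Proof.
have [h [a [b [c [<- <- _]]]]] := P_lift x y x.
rewrite -?(witt_map_zero h) -?(witt_map_one h) -!mapE.
apply: (congr1 (witt_map h)); apply: P_eq => n.
by rewrite !ghostE mulrC.
Qed.

Fact witt_mul1_transfer (x : witt p_pr B) :
  witt_mul (witt_one _) x = x.
Proof.
have [h [a [b [c [<- _ _]]]]] := P_lift x x x.
rewrite -?(witt_map_zero h) -?(witt_map_one h) -!mapE.
apply: (congr1 (witt_map h)); apply: P_eq => n.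
by rewrite !ghostE mul1r.
Qed.

Fact witt_mulDl_transfer (x y z : witt p_pr B) :
  witt_mul (witt_add x y) z =
  witt_add (witt_mul x z) (witt_mul y z).
Proof.
have [h [a [b [c [<- <- <-]]]]] := P_lift x y z.
rewrite -?(witt_map_zero h) -?(witt_map_one h) -!mapE.
apply: (congr1 (witt_map h)); apply: P_eq => n.
by rewrite !ghostE mulrDl.
Qed.

End Transfer.

Section RingAxioms.
Variable B : comNzRingType.

Fact wpoly_lift (x y z : witt p_pr B) : exists h : {rmorphism wpoly -> B},
  exists a b c : witt p_pr wpoly,
  [/\ witt_map h a = x, witt_map h b = y & witt_map h c = z].
Proof.
exists (weval (wargs x y z)); exists (Witt p_pr (wvar 0)).
exists (Witt p_pr (wvar 1)), (Witt p_pr (wvar 2)).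
by split; apply: wittP => n; exact: weval_var.
Qed.

Let P_inj := wpoly_ghost_inj p_pr.

Definition witt_addA := witt_addA_transfer P_inj wpoly_lift.
Definition witt_addC := witt_addC_transfer P_inj wpoly_lift.
Definition witt_add0 := witt_add0_transfer P_inj wpoly_lift.
Definition witt_addN := witt_addN_transfer P_inj wpoly_lift.
Definition witt_mulA := witt_mulA_transfer P_inj wpoly_lift.
Definition witt_mulC := witt_mulC_transfer P_inj wpoly_lift.
Definition witt_mul1 := witt_mul1_transfer P_inj wpoly_lift.
Definition witt_mulDl := witt_mulDl_transfer P_inj wpoly_lift.

End RingAxioms.

Fact witt_one_neq0 (B : comNzRingType) : witt_one B != witt_zero B.
Proof.
by apply/eqP => /(congr1 (fun u : witt p_pr B => u 0%N)) /eqP; rewrite /= oner_eq0.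
Qed.

HB.instance Definition _ (B : comNzRingType) :=
  GRing.isZmodule.Build (witt p_pr B)
    (@witt_addA B) (@witt_addC B) (@witt_add0 B) (@witt_addN B).
HB.instance Definition _ (B : comNzRingType) :=
  GRing.Zmodule_isComNzRing.Build (witt p_pr B)
    (@witt_mulA B) (@witt_mulC B) (@witt_mul1 B) (@witt_mulDl B)
    (@witt_one_neq0 B).

End WittRing.

Definition is_field_of_fractions (A : comNzRingType) (K : fieldType)
    (iota : {rmorphism A -> K}) : Prop :=
  injective iota /\
  forall x : K, exists a b : A, b != 0 /\ x = iota a / iota b.

Definition almost_integral (A : comNzRingType) (K : fieldType)
    (iota : {rmorphism A -> K}) (x : K) : Prop :=
  exists2 a : A, a != 0 &
    forall n, (1 <= n)%N -> exists c : A, iota a * x ^+ n = iota c.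

(* Both notions are meant for integral domains only; quantifying over all
   fields of fractions instead of fixing [{fraction A}] makes them applicable
   to a ring without a canonical [idomainType] structure, such as [witt], see
   [completely_integrally_closed_fraction]. *)
Definition completely_integrally_closed (A : comNzRingType) : Prop :=
  forall (K : fieldType) (iota : {rmorphism A -> K}),
    is_field_of_fractions iota ->
    forall x : K, almost_integral iota x -> exists a : A, x = iota a.

Definition integrally_closed (A : comNzRingType) : Prop :=
  forall (K : fieldType) (iota : {rmorphism A -> K}),
    is_field_of_fractions iota ->
    forall x : K, integralOver iota x -> exists a : A, x = iota a.

Lemma tofrac_field_of_fractions (A : idomainType) :
  is_field_of_fractions (@FracField.tofrac A : {rmorphism A -> {fraction A}}).
Proof.
split=> [a b /eqP|]; first by rewrite tofrac_eq => /eqP.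
elim/quotW=> r; exists (frac r).1, (frac r).2; rewrite denom_ratioP; split=> //.
apply: (canRL (mulfK _)); first by rewrite tofrac_eq0 denom_ratioP.
apply/eqP; rewrite -[_ * _]/(FracField.mul _ _) !piE /FracField.mulf.
rewrite FracField.equivfE !numden_Ratio ?oner_eq0 ?mulr1 ?denom_ratioP //.
by rewrite mulrC.
Qed.

Lemma completely_integrally_closed_fraction (A : idomainType) :
  completely_integrally_closed A <->
  forall x : {fraction A}, almost_integral (@FracField.tofrac A) x ->
    exists a : A, x = FracField.tofrac a.
Proof.
split=> [cicA x|cicA K iota [iota_inj fracK] x [d d0 dx]].
  exact: cicA (tofrac_field_of_fractions A) x.
have [a [b [b0 xE]]] := fracK x.
have ib0 : iota b != 0 by rewrite -(rmorph0 iota) (inj_eq iota_inj).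
have fb0 : FracField.tofrac b != 0 by rewrite tofrac_eq0.
have [|e eE] := cicA (FracField.tofrac a / FracField.tofrac b).
  exists d => // n /dx[c cE]; exists c.
  have {}cE : d * a ^+ n = c * b ^+ n.
    apply: iota_inj; rewrite !rmorphM !rmorphXn -cE xE expr_div_n.
    by rewrite -mulrA divfK // expf_neq0.
  rewrite expr_div_n mulrA; apply: (canLR (mulfK _)); first exact: expf_neq0.
  by rewrite -!rmorphXn -!rmorphM cE.
exists e; rewrite xE; apply: (canLR (mulfK _)) => //.
have /eqP : FracField.tofrac a = FracField.tofrac (e * b).
  by rewrite rmorphM /= -eE divfK.
by rewrite tofrac_eq -rmorphM => /eqP ->.
Qed.

(* Main.v *)
(** If [pi] is a regular element of a ring [A] that is [pi]-adically separated
    and complete, and [A / pi] is a completely integrally closed domain [B],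
    then [A] is a completely integrally closed domain.  Let [x = a / b] be
    almost integral, say [d x^n] in [A] for all [n].  Since [pi] is prime, its
    powers can be cancelled until [pi] divides neither [d] nor [b]; then
    [a / b] modulo [pi] is almost integral over [B], so [x = e + pi x'] with [e]
    in [A], and [x'] is again of the form [a' / b] and almost integral with the
    same [d].  Iterating gives the [pi]-adic expansion of [x].  For a perfect
    ring [B] of characteristic [p], this applies to [A = W(B)] and [pi = p],
    because [p (x_0, x_1, ...) = (0, x_0^p, x_1^p, ...)]. *)
From HB Require Import structures.
Require Import Defs.
From mathcomp Require Import all_boot all_order all_algebra.
From mathcomp Require Import finmap boolp ring.
From mathcomp.multinomials Require Import monalg.

Set Implicit Arguments.
Unset Strict Implicit.
Unset Printing Implicit Defensive.

Import GRing.Theory.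

Local Open Scope ring_scope.

(** * Almost integrality expressed by numerators and denominators *)

(* [a / b] is almost integral with common denominator [d], without fractions. *)
Definition almost_integral_ratio (A : comNzRingType) (d a b : A) : Prop :=
  forall n, exists c, d * a ^+ n = c * b ^+ n.

(** In the binomial expansion of [(a - e * b) ^+ n], the term with [a ^+ (n - i)] carries a factor
    [b ^+ i], which supplies the powers of [b] missing from the relation for [n - i]. *)
Lemma almost_integral_ratioB (A : comNzRingType) (d a b e : A) :
  almost_integral_ratio d a b -> almost_integral_ratio d (a - e * b) b.
Proof.
move=> dab n; rewrite exprBn mulr_sumr.
apply: (big_ind (fun y => exists c, y = c * b ^+ n)).
- by exists 0; rewrite mul0r.
- by move=> _ _ [c ->] [c' ->]; exists (c + c'); rewrite mulrDl.
move=> i _; have [c cE] := dab (n - i)%N.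
exists (((-1) ^+ i * c * e ^+ i) *+ 'C(n, i)).
have le_in : (i <= n)%N by rewrite -ltnS.
have bE : b ^+ n = b ^+ (n - i) * b ^+ i by rewrite -exprD subnK.
rewrite bE exprMn mulrnAr mulrnAl; congr (_ *+ _).
transitivity ((-1) ^+ i * e ^+ i * b ^+ i * (d * a ^+ (n - i))); first by ring.
by rewrite cE; ring.
Qed.

Lemma completely_integrally_closed_ratio (B : idomainType) (d a b : B) :
  completely_integrally_closed B -> d != 0 -> b != 0 ->
  almost_integral_ratio d a b -> exists e, a = e * b.
Proof.
move=> cicB d0 b0 dab.
have fb0 : FracField.tofrac b != 0 by rewrite tofrac_eq0.
have [|e eE] := cicB _ _ (tofrac_field_of_fractions B)
    (FracField.tofrac a / FracField.tofrac b).
  exists d => // n _; have [c cE] := dab n; exists c.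
  rewrite expr_div_n mulrA; apply: (canLR (mulfK _)); first exact: expf_neq0.
  by rewrite -!rmorphXn -!rmorphM cE.
exists e; apply: (tofrac_field_of_fractions B).1.
by rewrite rmorphM -eE divfK.
Qed.

(** If [x = a / b] is a root of a monic polynomial of degree [d], then [b ^+ d] clears the
    denominators of [x ^+ n] for [n < d]. The monic equation reduces every higher power to lower
    ones. *)
Lemma completely_integrally_closed_integrally_closed (A : comNzRingType) :
  completely_integrally_closed A -> integrally_closed A.
Proof.
move=> cicA K iota fracK x [q q_monic /rootP qx]; apply: cicA (fracK) _ _.
have [iota_inj /(_ x)[a [b [b0 xE]]]] := fracK.
have ib0 : iota b != 0 by rewrite -(rmorph0 iota) (inj_eq iota_inj).
pose d := (size q).-1; exists (b ^+ d).
  by rewrite -(inj_eq iota_inj) rmorph0 rmorphXn expf_neq0.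
have sq : size q = d.+1 by rewrite prednK // size_poly_gt0 monic_neq0.
have xd : x ^+ d = - \sum_(i < d) iota q`_i * x ^+ i.
  move: qx; rewrite (@horner_coef_wide _ d.+1); last first.
    by rewrite -sq size_poly.
  rewrite big_ord_recr /= coef_map /= -[d in q`_d]/((size q).-1).
  rewrite -lead_coefE (monicP q_monic) rmorph1 mul1r => /eqP.
  rewrite addrC addr_eq0 => /eqP ->; congr (- _).
  by apply: eq_bigr => i _; rewrite coef_map.
move=> n _; elim/ltn_ind: n => n IHn; case: (ltnP n d) => [lt_nd|le_dn].
  exists (b ^+ (d - n) * a ^+ n); rewrite xE expr_div_n.
  rewrite -[in LHS](subnK (ltnW lt_nd)) exprD !rmorphM !rmorphXn -mulrA.
  by rewrite [X in _ * X]mulrC divfK // expf_neq0.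
rewrite -(subnK le_dn) exprD xd mulrN mulr_sumr mulrN mulr_sumr.
suff [c ->] : exists c,
    \sum_(i < d) iota (b ^+ d) * (x ^+ (n - d) * (iota q`_i * x ^+ i)) = iota c.
  by exists (- c); rewrite rmorphN.
apply: (big_ind (fun y => exists c, y = iota c)).
- by exists 0; rewrite rmorph0.
- by move=> _ _ [c ->] [c' ->]; exists (c + c'); rewrite rmorphD.
move=> i _; have [|c cE] := IHn (n - d + i)%N.
  by rewrite -[X in (_ < X)%N](subnK le_dn) ltn_add2l.
by exists (q`_i * c); rewrite rmorphM -cE exprD; ring.
Qed.

(** * Lifting complete integral closedness along [A -> A / pi] *)

Section AdicLifting.
Variables (A : comNzRingType) (B : idomainType) (r : {rmorphism A -> B}) (pi : A).
Hypothesis r_surj : forall b, exists a, r a = b.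
Hypothesis ker_r : forall a, r a = 0 <-> exists q, a = pi * q.
Hypothesis pi_reg : forall a, pi * a = 0 -> a = 0.
Hypothesis pi_sep : forall a, (forall n, exists q, a = pi ^+ n * q) -> a = 0.

Lemma adic_powI n : injective ( *%R (pi ^+ n)).
Proof.
move=> a a' /eqP; rewrite -subr_eq0 -mulrBr => /eqP e0.
apply/eqP; rewrite -subr_eq0; apply/eqP.
elim: n e0 => [|n IHn]; first by rewrite mul1r.
by rewrite exprS -mulrA => /pi_reg.
Qed.

(** Since [B] is a domain, [pi] is prime: it divides [v] as soon as it divides [u * v]. Regularity
    of [pi] then removes one factor at a time. *)
Lemma adic_cancel n u v q : r u != 0 -> u * v = pi ^+ n * q ->
  exists q', v = pi ^+ n * q'.
Proof.
move=> u0; elim: n v q => [|n IHn] v q; first by exists v; rewrite mul1r.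
rewrite exprS -mulrA => uv.
have /ker_r[v' vE] : r v = 0.
  have : r (u * v) = 0 by apply/ker_r; exists (pi ^+ n * q).
  by rewrite rmorphM => /eqP; rewrite mulf_eq0 (negPf u0) => /eqP.
have [|q' v'E] := IHn v' q; last by exists q'; rewrite vE v'E mulrA -exprS.
by apply: (@adic_powI 1); rewrite !expr1 -uv vE mulrCA.
Qed.

(** Otherwise each quotient of [a] by a power of [pi] would again be divisible by [pi], and
    separatedness would force [a = 0]. *)
Lemma adic_factor a : a != 0 -> exists n u, a = pi ^+ n * u /\ r u != 0.
Proof.
move=> a0; apply: contrapT => no; case/eqP: a0; apply: pi_sep; elim=> [|n [q qE]].
  by exists a; rewrite mul1r.
have [/ker_r[q' q'E]|q0] := pselect (r q = 0).
  by exists q'; rewrite qE q'E mulrA -exprSr.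
by case: no; exists n, q; split=> //; apply/eqP.
Qed.

Lemma adic_integral_domain : GRing.integral_domain_axiom A.
Proof.
move=> a b ab0; have [//|a0] := eqVneq a 0; have [//|b0] := eqVneq b 0.
have [n [u [aE u0]]] := adic_factor a0; have [m [v [bE v0]]] := adic_factor b0.
have /(congr1 r)/eqP : u * v = 0.
  apply: (@adic_powI (n + m)%N); rewrite /= mulr0 -[RHS]ab0 aE bE.
  by rewrite exprD mulrACA.
by rewrite rmorphM rmorph0 mulf_eq0 (negPf u0) (negPf v0).
Qed.

(** The powers of [b] stay nonzero modulo [pi], so in [pi ^+ n * d * a ^+ m = c * b ^+ m] the factor
    [pi ^+ n] must divide [c]. *)
Lemma adic_ratio_cancel_denominator n d a b : r b != 0 ->
  almost_integral_ratio (pi ^+ n * d) a b -> almost_integral_ratio d a b.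
Proof.
move=> b0 dab m; have [c cE] := dab m.
have bm0 : r (b ^+ m) != 0 by rewrite rmorphXn expf_neq0.
have [|c' c'E] := @adic_cancel n (b ^+ m) c (d * a ^+ m) bm0.
  by rewrite mulrC -cE mulrA.
by exists c'; apply: (@adic_powI n); rewrite /= !mulrA cE c'E.
Qed.

Lemma adic_ratio_divide d a b : r b != 0 ->
  almost_integral_ratio d (pi * a) b -> almost_integral_ratio d a b.
Proof.
move=> b0 dab m; have [c cE] := dab m.
have bm0 : r (b ^+ m) != 0 by rewrite rmorphXn expf_neq0.
rewrite exprMn mulrCA in cE.
have [|c' c'E] := @adic_cancel m (b ^+ m) c (d * a ^+ m) bm0.
  by rewrite mulrC -cE.
by exists c'; apply: (@adic_powI m); rewrite /= cE c'E mulrA.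
Qed.

Lemma adic_ratio_reduce n d a b : d != 0 ->
  almost_integral_ratio d a (pi ^+ n * b) ->
  exists2 a', a = pi ^+ n * a' & almost_integral_ratio d a' b.
Proof.
move=> d0; elim: n a => [|n IHn] a.
  by rewrite expr0 mul1r => dab; exists a; rewrite ?mul1r.
rewrite exprS -mulrA => dab.
have /ker_r[a' aE] : r a = 0.
  (* If [pi] did not divide [a], then the relation for [m], whose right-hand side contains
     [pi ^+ m], would make [pi ^+ m] divide [d] for every [m]. *)
  apply/eqP; apply: contraNT d0 => a0; apply/eqP/pi_sep => m.
  have [c cE] := dab m.
  have am0 : r (a ^+ m) != 0 by rewrite rmorphXn expf_neq0.
  apply: (@adic_cancel m (a ^+ m) d (c * (pi ^+ n * b) ^+ m) am0).
  by rewrite mulrC cE exprMn mulrCA.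
have [|a'' a'E da''b] := IHn a'.
  move=> m; have [c cE] := dab m; exists c; apply: (@adic_powI m) => /=.
  by rewrite mulrCA -exprMn -aE cE exprMn mulrCA.
by exists a'' => //; rewrite aE a'E mulrA.
Qed.

Hypothesis cicB : completely_integrally_closed B.

Lemma adic_ratio_step d a b : r d != 0 -> r b != 0 ->
  almost_integral_ratio d a b ->
  exists e a', a = e * b + pi * a' /\ almost_integral_ratio d a' b.
Proof.
move=> d0 b0 dab.
have [|e' reE] := completely_integrally_closed_ratio (a := r a) cicB d0 b0.
  by move=> n; have [c cE] := dab n; exists (r c); rewrite -!rmorphXn -!rmorphM cE.
have [e eE] := r_surj e'.
have /ker_r[a' a'E] : r (a - e * b) = 0.
  by rewrite rmorphB rmorphM eE reE subrr.
exists e, a'; split; first by rewrite -a'E addrC subrK.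
by apply: adic_ratio_divide => //; rewrite -a'E; apply: almost_integral_ratioB.
Qed.

Hypothesis pi_complete : forall e : nat -> A, exists E, forall n,
  exists q, E = \sum_(i < n) pi ^+ i * e i + pi ^+ n * q.

Lemma adic_ratio_integral d a b : r d != 0 -> r b != 0 ->
  almost_integral_ratio d a b -> exists e, a = e * b.
Proof.
(* Packing a numerator with its almost integrality makes the step a map from [T] to [A * T], which
   can be iterated; its first components are the [pi]-adic digits of [a / b]. *)
move=> d0 b0 dab; pose T := {a | almost_integral_ratio d a b}.
have /choice[f fP] (t : T) : exists et : A * T, sval t = et.1 * b + pi * sval et.2.
  case: t => a1 a1P; have [e [a2 [aE a2P]]] := adic_ratio_step d0 b0 a1P.
  by exists (e, exist _ a2 a2P).
pose t n := iter n (fun t => (f t).2) (exist _ a dab : T).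
have tE n : a = (\sum_(i < n) pi ^+ i * (f (t i)).1) * b + pi ^+ n * sval (t n).
  elim: n => [|n {1}->]; first by rewrite big_ord0 mul0r add0r mul1r.
  rewrite big_ord_recr /= fP mulrDr addrA; congr (_ + _); last first.
    by rewrite mulrA -exprSr.
  by rewrite mulrDl mulrA.
have [E EP] := pi_complete (fun i => (f (t i)).1); exists E.
(* Both [a] and [E * b] agree modulo [pi ^+ n] with the [n]-th partial sum times [b]. *)
apply/eqP; rewrite -subr_eq0; apply/eqP/pi_sep => n; have [q ->] := EP n.
exists (sval (t n) - q * b); rewrite {1}(tE n) mulrDl opprD addrACA subrr add0r.
by rewrite mulrBr mulrA.
Qed.

Theorem adic_completely_integrally_closed : completely_integrally_closed A.
Proof.
move=> K iota [iota_inj fracK] x [d d0 dx].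
have [a [b [b0 xE]]] := fracK x.
have ib0 : iota b != 0 by rewrite -(rmorph0 iota) (inj_eq iota_inj).
have dab : almost_integral_ratio d a b.
  (* Almost integrality only concerns exponents at least 1; the exponent 0 has the witness [d]. *)
  case=> [|n]; first by exists d.
  have [c cE] := dx n.+1 isT; exists c; apply: iota_inj.
  by rewrite !rmorphM !rmorphXn -cE xE expr_div_n -mulrA divfK // expf_neq0.
have [m [b' [bE b'0]]] := adic_factor b0; have [n [d' [dE d'0]]] := adic_factor d0.
(* The order matters: powers of [pi] leave [b] first, because cancelling them from [d] requires a
   denominator that is nonzero modulo [pi]. *)
rewrite bE in dab; have [a' aE] := adic_ratio_reduce d0 dab.
rewrite dE => /(adic_ratio_cancel_denominator b'0).
case/(adic_ratio_integral d'0 b'0) => e a'E; exists e.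
rewrite xE; apply: (canLR (mulfK ib0)).
by rewrite -rmorphM aE a'E bE mulrCA.
Qed.

End AdicLifting.

(** * Ghost congruences and multiplication by [p] *)

Section WittVectors.
Variables (p : nat) (p_pr : prime p).

Lemma ghost_mulrn (R : comNzRingType) n m (x : witt p_pr R) :
  ghost p n (x *+ m) = ghost p n x *+ m.
Proof.
elim: m => [|m IHm]; first exact: ghost_wzero.
by rewrite !mulrS -IHm; exact: ghost_wadd.
Qed.

Lemma witt_map_mulrn (R S : comNzRingType) (h : {rmorphism R -> S}) m
    (x : witt p_pr R) : witt_map h (x *+ m) = witt_map h x *+ m.
Proof.
elim: m => [|m IHm]; first exact: witt_map_zero.
by rewrite !mulrS -IHm; exact: witt_map_add.
Qed.

(** By induction the terms below [n] of the two ghost components agree modulo [p ^ n.+1].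
    Subtracting them leaves a congruence between [p ^ n] multiples of the last coordinates, where
    [p ^ n] cancels. *)
Lemma pcong_ghost (R : comNzRingType) (s t : nat -> R) :
  (forall n, injective ( *%R (p%:R ^+ n : R))) ->
  (forall n, pcong p n.+1 (ghost p n s) (ghost p n t)) ->
  forall n, pcong p 1 (s n) (t n).
Proof.
move=> inj st; elim/ltn_ind => n IHn.
have tail : pcong p n.+1
    (\sum_(i < n) p%:R ^+ i * s i ^+ (p ^ (n - i)))
    (\sum_(i < n) p%:R ^+ i * t i ^+ (p ^ (n - i))).
  apply: pcong_sum => i.
  have {1}-> : n.+1 = (i + (n - i).+1)%N by rewrite addnS subnKC // ltnW.
  by apply/pcong_pM/pcong_exppn/IHn.
have := pcongD (pcongN tail) (st n); rewrite !ghost_recr !addKr => -[q qE].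
by exists q; apply: (inj n); rewrite /= qE mulrDr expr1 mulrA -exprSr.
Qed.

Lemma ghost_inj_trunc (R : comNzRingType) n (s t : nat -> R) :
  (forall i, injective ( *%R (p%:R ^+ i : R))) ->
  (forall i, (i < n)%N -> ghost p i s = ghost p i t) ->
  forall i, (i < n)%N -> s i = t i.
Proof.
move=> inj st; elim/ltn_ind => i IHi lt_in; have := st i lt_in.
rewrite !ghost_recr (@eq_ghost_tail _ _ _ s t) => [/addrI/inj //|j lt_ji].
exact: IHi (ltn_trans lt_ji lt_in).
Qed.

Lemma eq_ghost_trunc (R : comNzRingType) n (s t : nat -> R) :
  (forall i, (i < n)%N -> s i = t i) ->
  forall i, (i < n)%N -> ghost p i s = ghost p i t.
Proof.
move=> st i lt_in; apply: eq_bigr => j _; rewrite st //.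
by apply: leq_ltn_trans lt_in; rewrite -ltnS.
Qed.

Lemma wpoly_pXI n : injective ( *%R (p%:R ^+ n : wpoly)).
Proof. by rewrite -natrX; apply: wpoly_natrI; rewrite expn_gt0 prime_gt0. Qed.

(** The two sides differ exactly by the last term [p ^ n.+1 * x n]: the shift turns the other terms
    of [p] times the ghost component into its own. *)
Lemma ghost_frob_shift (R : comNzRingType) n (x : nat -> R) :
  pcong p n.+1 (ghost p n x *+ p)
    (ghost p n (fun i => if i is j.+1 then x j ^+ p else 0)).
Proof.
case: n => [|n].
  exists (x 0%N); rewrite !(ghost_recr p) !big_ord0 !add0r !mul1r /= add0r expr1.
  by rewrite mulr_natl.
exists (x n.+1); rewrite [ghost p _ x]ghost_recr -[LHS]mulr_natl mulrDr /ghost.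
rewrite [in RHS]big_ord_recl /= expr0n eqn0Ngt expn_gt0 prime_gt0 //= mulr0 add0r.
rewrite [p%:R ^+ n.+2]exprS -mulrA; congr (_ + _).
rewrite mulr_sumr; apply: eq_bigr => i _; rewrite /bump /= add1n mulrA -exprS subSS.
by rewrite -exprM -expnS subSn // -ltnS.
Qed.

(** Over [wpoly], where powers of [p] are regular, ghost components show that both sides are
    congruent modulo [p]; the map to [B] kills [p]. *)
Lemma witt_mulrp (B : comNzRingType) (x : witt p_pr B) n : p \in [pchar B] ->
  (x *+ p) n = if n is m.+1 then x m ^+ p else 0.
Proof.
move=> charB; have [h [X [_ [_ [<- _ _]]]]] := wpoly_lift x x x.
rewrite -witt_map_mulrn /=.
pose Z m := if m is m'.+1 then X m' ^+ p else 0.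
suff [q ->] : pcong p 1 ((X *+ p) n) (Z n).
  rewrite rmorphD rmorphM expr1 rmorph_nat (pcharf0 charB) mul0r addr0.
  by case: n => [|n] /=; rewrite ?rmorph0 ?rmorphXn.
apply: (pcong_ghost wpoly_pXI) => m; rewrite ghost_mulrn.
exact: ghost_frob_shift.
Qed.

(** * Truncated addition and the zeroth coordinate as a ring morphism *)

Section Truncation.
Variable B : comNzRingType.
Implicit Types x y z : witt p_pr B.

Lemma witt_add_trunc n x y z : (forall i, (i < n)%N -> x i = y i) ->
  forall i, (i < n)%N -> (x + z) i = (y + z) i.
Proof.
move=> xy.
pose X := Witt p_pr (wvar 0); pose Z := Witt p_pr (wvar 2).
(* Sharing the first [n] indeterminates with [X] turns the hypothesis into an identity over [wpoly],
   where ghost components determine coordinates. The map [h] still sends [Y] to [y], as [x] and [y]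
   agree below [n]. *)
pose Y := Witt p_pr (fun i => if (i < n)%N then wvar 0 i else wvar 1 i).
pose h : {rmorphism wpoly -> B} := weval (wargs x y z).
have hX : witt_map h X = x by apply: wittP => i; exact: weval_var.
have hZ : witt_map h Z = z by apply: wittP => i; exact: weval_var.
have hY : witt_map h Y = y.
  apply: wittP => i; rewrite /=; case: ifP => [lt_in|_].
    by rewrite -xy //; exact: weval_var.
  exact: weval_var.
suff XY i : (i < n)%N -> (X + Z) i = (Y + Z) i.
  move=> i /XY/(congr1 h) XYi; rewrite -hX -hY -hZ.
  have E (U V : witt p_pr wpoly) : witt_map h U + witt_map h V = witt_map h (U + V).
    by symmetry; exact: witt_map_add.
  by rewrite !E.
apply: (ghost_inj_trunc wpoly_pXI) => {}i lt_in.
apply: etrans (ghost_wadd i X Z) _; apply: etrans _ (esym (ghost_wadd i Y Z)).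
apply: (congr1 (+%R^~ (ghost p i Z))); apply: (eq_ghost_trunc _ lt_in) => j lt_jn.
by rewrite /Y /= lt_jn.
Qed.

Lemma wcoord0_add x y : (x + y) 0%N = x 0%N + y 0%N.
Proof.
by have := ghost_wadd 0 x y; rewrite !ghost_recr !big_ord0 !add0r !mul1r.
Qed.

Lemma wcoord0_mul x y : (x * y) 0%N = x 0%N * y 0%N.
Proof.
by have := ghost_wmul 0 x y; rewrite !ghost_recr !big_ord0 !add0r !mul1r.
Qed.

Definition wcoord0 x : B := x 0%N.

Fact wcoord0_is_additive : zmod_morphism wcoord0.
Proof.
move=> x y; apply/eqP; rewrite eq_sym subr_eq; apply/eqP.
by rewrite -[RHS]wcoord0_add subrK.
Qed.

Fact wcoord0_is_multiplicative : monoid_morphism wcoord0.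
Proof. by split; [|exact: wcoord0_mul]. Qed.

HB.instance Definition _ :=
  GRing.isZmodMorphism.Build (witt p_pr B) B wcoord0 wcoord0_is_additive.
HB.instance Definition _ :=
  GRing.isMonoidMorphism.Build (witt p_pr B) B wcoord0 wcoord0_is_multiplicative.

End Truncation.

(** * The [p]-adic topology of Witt vectors over a perfect domain *)

Section Perfect.
Variables (B : idomainType) (charB : p \in [pchar B]).
Hypothesis perfectB : bijective (pFrobenius_aut charB).
Local Notation W := (witt p_pr B).
Implicit Types x y : W.

Lemma witt_coord_pX n x i : (i < n)%N -> (p%:R ^+ n * x) i = 0.
Proof.
elim: n i => // n IHn i lt_in; rewrite exprS -mulrA mulr_natl witt_mulrp //.
case: i lt_in => // i /IHn ->.
by rewrite expr0n eqn0Ngt prime_gt0.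
Qed.

(** A vector with zero head is [p] times the vector of [p]-th roots of its shifted coordinates; the
    roots exist because Frobenius is surjective. *)
Lemma witt_pX_dvd n x : (forall i, (i < n)%N -> x i = 0) ->
  exists y, x = p%:R ^+ n * y.
Proof.
have [g _ gK] := perfectB.
elim: n x => [|n IHn] x x0; first by exists x; rewrite mul1r.
pose y := Witt p_pr (fun i => g (x i.+1)).
have xE : x = p%:R * y.
  apply: wittP => i; rewrite mulr_natl witt_mulrp //.
  by case: i => [|i]; [exact: x0|exact: esym (gK _)].
have [i lt_in|z yE] := IHn y.
  by rewrite /= x0 //; apply: (bij_inj perfectB); rewrite gK rmorph0.
by exists z; rewrite xE yE mulrA -exprS.
Qed.

Lemma wcoord0_eq0 x : wcoord0 x = 0 <-> exists y, x = p%:R * y.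
Proof.
split=> [x0|[y ->]]; first by apply: (@witt_pX_dvd 1); case.
exact: (@witt_coord_pX 1).
Qed.

(** The coordinates of [p%:R * x] after the first are the [p]-th powers of those of [x], and a
    domain has no nilpotents. *)
Lemma witt_p_regular x : p%:R * x = 0 -> x = 0.
Proof.
move=> px0; apply: wittP => i; apply/eqP.
have : (p%:R * x) i.+1 = 0 by rewrite px0.
by rewrite mulr_natl witt_mulrp // => /eqP; rewrite expf_eq0 => /andP[].
Qed.

Lemma witt_p_separated x : (forall n, exists y, x = p%:R ^+ n * y) -> x = 0.
Proof.
by move=> xP; apply: wittP => i; have [y ->] := xP i.+1; exact: witt_coord_pX.
Qed.

Lemma witt_p_complete (e : nat -> W) : exists E, forall n,
  exists y, E = \sum_(i < n) p%:R ^+ i * e i + p%:R ^+ n * y.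
Proof.
pose S n := \sum_(i < n) p%:R ^+ i * e i.
have SE n : S n.+1 = p%:R ^+ n * e n + S n by rewrite /S big_ord_recr addrC.
have truncS n i k : (i < n)%N -> S (n + k)%N i = S n i.
  move=> lt_in; elim: k => [|k <-]; first by rewrite addn0.
  (* The new summand is a multiple of [p%:R ^+ (n + k)], so its coordinates below [n] vanish and it
     may be replaced by 0. *)
  rewrite addnS SE (@witt_add_trunc B n _ 0) ?add0r // => j lt_jn.
  by rewrite witt_coord_pX // ltn_addr.
(* Coordinate [i] of the partial sums is constant from [S i.+1] on, so the diagonal collects the
   stable values. *)
pose E : W := Witt p_pr (fun i => S i.+1 i); exists E => n.
have [i lt_in|y yE] := @witt_pX_dvd n (E - S n).
  rewrite (@witt_add_trunc B n _ (S n)) ?subrr // => j lt_jn.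
  by rewrite /= -(truncS j.+1 j (n - j.+1)%N) // subnKC.
by exists y; rewrite -yE addrC subrK.
Qed.

End Perfect.

End WittVectors.

Theorem corollary5p10 (p : nat) (p_pr : prime p) (B : idomainType)
    (charB : p \in [pchar B]) (perfectB : bijective (pFrobenius_aut charB))
    (cicB : completely_integrally_closed B) :
  [/\ GRing.integral_domain_axiom (witt p_pr B),
      completely_integrally_closed (witt p_pr B)
    & integrally_closed (witt p_pr B)].
Proof.
have ker := @wcoord0_eq0 p p_pr B charB perfectB.
have reg := @witt_p_regular p p_pr B charB.
have sep := @witt_p_separated p p_pr B charB.
have surj (b : B) : exists x : witt p_pr B, wcoord0 x = b.
  by exists (Witt p_pr (fun _ => b)).
have cicW : completely_integrally_closed (witt p_pr B).
  apply: adic_completely_integrally_closed surj ker reg sep cicB _.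
  exact: witt_p_complete perfectB.
split=> //; first exact: adic_integral_domain ker reg sep.
exact: completely_integrally_closed_integrally_closed.
Qed.
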